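(* Let $f\colon\mathbb{Z}\times\mathbb{R}^n\to\mathbb{R}^n$ be continuous. Suppose the system $x(k+1)=f(k,x(k))$, $k\in\mathbb{Z}$, is uniformly globally asymptotically incrementally stable and there exists a nonempty compact set $\mathbb{X}\subset\mathbb{R}^n$ that is positively invariant under the system. Then the system is uniformly globally convergent. Moreover, if the incremental attraction rate is exponential (i.e. the system is uniformly globally exponentially incrementally stable), then the system is uniformly globally exponentially convergent.
   Context: $|\cdot|$ is the Euclidean norm. For $k_0\in\mathbb{Z}$ and $\xi\in\mathbb{R}^n$, $\phi(\cdot;k_0,\xi)\colon\mathbb{Z}_{\geq k_0}\to\mathbb{R}^n$ denotes the solution: $\phi(k_0;k_0,\xi)=\xi$ and $\phi(k+1;k_0,\xi)=f(k,\phi(k;k_0,\xi))$ for all $k\geq k_0$. A set $\mathbb{X}\subseteq\mathbb{R}^n$ is positively invariant if $\phi(k;k_0,\xi)\in\mathbb{X}$ for all $\xi\in\mathbb{X}$ and $k,k_0\in\mathbb{Z}$ with $k\geq k_0$. A function is of class $\mathcal{K}$ if it maps $\mathbb{R}_{\geq0}\to\mathbb{R}_{\geq0}$, is continuous, zero at zero and strictly increasing; of class $\mathcal{L}$ if it maps $\mathbb{R}_{\geq0}\to\mathbb{R}_{\geq0}$, is continuous, strictly decreasing and tends to $0$ at infinity. $\beta\colon\mathbb{R}_{\geq0}\times\mathbb{R}_{\geq0}\to\mathbb{R}_{\geq0}$ is of class $\mathcal{KL}$ if it is of class $\mathcal{K}$ in its first argument and of class $\mathcal{L}$ in its second argument (with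 the convention $\beta(0,t)=0$ for all $t\geq0$). The system is uniformly globally asymptotically incrementally stable if there exists $\beta\in\mathcal{KL}$ such that $|\phi(k;k_0,\xi_1)-\phi(k;k_0,\xi_2)|\leq\beta(|\xi_1-\xi_2|,k-k_0)$ for all $\xi_1,\xi_2\in\mathbb{R}^n$ and $k,k_0\in\mathbb{Z}$ with $k\geq k_0$. It is uniformly globally exponentially incrementally stable if there exist $\kappa\geq1$ and $\lambda>1$ such that $|\phi(k;k_0,\xi_1)-\phi(k;k_0,\xi_2)|\leq\kappa|\xi_1-\xi_2|\lambda^{-(k-k_0)}$ for all such $\xi_1,\xi_2,k,k_0$. The system is uniformly globally convergent if (a) there exists a unique bounded solution $\bar x(k)$ defined for all $k\in\mathbb{Z}$ (i.e. $\bar x\colon\mathbb{Z}\to\mathbb{R}^n$ bounded with $\bar x(k+1)=f(k,\bar x(k))$ for all $k\in\mathbb{Z}$), and (b) there exists $\beta\in\mathcal{KL}$ such that $|\phi(k;k_0,\xi)-\bar x(k)|\leq\beta(|\xi-\bar x(k_0)|,k-k_0)$ for all $\xi\in\mathbb{R}^n$ and $k,k_0\in\mathbb{Z}$ with $k\geq k_0$. It is uniformly globally exponentially convergent if moreover $\beta$ can be chosen as $\beta(s,k-k_0)=\kappa s\lambda^{-(k-k_0)}$ for some $\kappa\geq1$, $\lambda>1$. *)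

(* Defs.v *)
From HB Require Import structures.
From mathcomp Require Import all_boot all_order all_algebra.
From mathcomp Require Import all_classical all_reals all_analysis.
Import Order.TTheory GRing.Theory Num.Theory.
Import numFieldNormedType.Exports.

Set Implicit Arguments.
Unset Strict Implicit.
Unset Printing Implicit Defensive.

Local Open Scope classical_set_scope.
Local Open Scope ring_scope.

(* The library norm on row vectors is the sup norm; it induces the same
   topology as this one. *)
Definition enorm (R : realType) (n : nat) (x : 'rV[R]_n) : R :=
  Num.sqrt (\sum_(i < n) x 0 i ^+ 2).

(* Comparison functions are total functions on R of which only the values at
   nonnegative arguments are ever constrained or used. *)
Definition class_K (R : realType) (g : R -> R) : Prop :=
  [/\ forall s, 0 <= s -> 0 <= g s,
      {within `[0, +oo[%classic, continuous g},
      g 0 = 0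
    & forall s t, 0 <= s -> s < t -> g s < g t].

Definition class_L (R : realType) (g : R -> R) : Prop :=
  [/\ forall t, 0 <= t -> 0 <= g t,
      {within `[0, +oo[%classic, continuous g},
      forall s t, 0 <= s -> s < t -> g t < g s
    & g t @[t --> +oo] --> 0].

(* Since class_K forces beta 0 t = 0, the map beta 0 cannot be strictly
   decreasing: the class-L requirement concerns s > 0 only. *)
Definition class_KL (R : realType) (beta : R -> R -> R) : Prop :=
  (forall t, 0 <= t -> class_K (beta^~ t)) /\
  (forall s, 0 < s -> class_L (beta s)).

Section System.
Variables (R : realType) (n : nat).
Implicit Types (f : int -> 'rV[R]_n -> 'rV[R]_n) (xi : 'rV[R]_n)
  (k : int) (xbar : int -> 'rV[R]_n) (X : set 'rV[R]_n).

(* Joint continuity, the time set int carrying the discrete topology. *)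
Definition continuous_system f : Prop :=
  continuous (fun p : discrete_topology int * 'rV[R]_n => f p.1 p.2).

Fixpoint phi_nat f k0 xi (j : nat) : 'rV[R]_n :=
  if j is i.+1 then f (k0 + i%:Z) (phi_nat f k0 xi i) else xi.

(* Only meaningful for k0 <= k. *)
Definition phi f k k0 xi : 'rV[R]_n := phi_nat f k0 xi (absz (k - k0)%R).

Lemma phi_init f k0 xi : phi f k0 k0 xi = xi.
Proof. by rewrite /phi subrr. Qed.

Lemma phi_step f k k0 xi : k0 <= k ->
  phi f (k + 1) k0 xi = f k (phi f k k0 xi).
Proof.
rewrite -subr_ge0 /phi => h.
have -> : absz (k + 1 - k0)%R = (absz (k - k0)%R).+1.
  by rewrite addrAC; case: (k - k0) h => // m _; rewrite -PoszD addn1.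
by rewrite /= gez0_abs // addrC subrK.
Qed.

Definition positively_invariant f X : Prop :=
  forall xi k k0, X xi -> k0 <= k -> X (phi f k k0 xi).

Definition incrementally_stable f : Prop :=
  exists beta : R -> R -> R, class_KL beta /\
    forall xi1 xi2 k k0, k0 <= k ->
      enorm (phi f k k0 xi1 - phi f k k0 xi2)
        <= beta (enorm (xi1 - xi2)) (k - k0)%:~R.

Definition exp_incrementally_stable f : Prop :=
  exists kappa lambda : R, [/\ 1 <= kappa, 1 < lambda &
    forall xi1 xi2 k k0, k0 <= k ->
      enorm (phi f k k0 xi1 - phi f k k0 xi2)
        <= kappa * enorm (xi1 - xi2) * lambda ^ (- (k - k0))].

Definition bounded_solution f xbar : Prop :=
  (forall k, xbar (k + 1) = f k (xbar k)) /\
  (exists M : R, forall k, enorm (xbar k) <= M).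

Definition attraction_bound f xbar (beta : R -> R -> R) : Prop :=
  forall xi k k0, k0 <= k ->
    enorm (phi f k k0 xi - xbar k) <= beta (enorm (xi - xbar k0)) (k - k0)%:~R.

Definition convergent_system f : Prop :=
  exists xbar, unique (bounded_solution f) xbar /\
    exists beta, class_KL beta /\ attraction_bound f xbar beta.

Definition exp_convergent_system f : Prop :=
  exists xbar, unique (bounded_solution f) xbar /\
    exists beta, [/\ class_KL beta, attraction_bound f xbar beta &
      exists kappa lambda : R, [/\ 1 <= kappa, 1 < lambda &
        forall (s : R) k k0, 0 <= s -> k0 <= k ->
          beta s (k - k0)%:~R = kappa * s * lambda ^ (- (k - k0))]].

End System.

(* Main.v *)
(** The bounded solution is a pullback limit: choose [xi] in [X], start from it
    at time [k - j] and let [j] tend to infinity. Two such trajectories differ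
    at time [k - j] by at most a bound depending on [X] only, so by incremental
    stability the states at time [k] form a Cauchy sequence, and continuity of
    [f k] makes the limits a solution. Comparing two bounded solutions over the
    window from [k - j] to [k] gives uniqueness, and incremental stability
    against the bounded solution is convergence. *)

Require Import Defs.
From HB Require Import structures.
From mathcomp Require Import all_boot all_order all_algebra.
From mathcomp Require Import all_classical all_reals all_analysis.
From mathcomp Require Import lra.
Import Order.TTheory GRing.Theory Num.Theory.
Import numFieldNormedType.Exports.
Local Open Scope classical_set_scope.
Local Open Scope ring_scope.

Lemma enorm_ge0 {R : realType} {n} (x : 'rV[R]_n) : 0 <= enorm x.
Proof. exact: sqrtr_ge0. Qed.

Lemma sqr_enorm {R : realType} {n} (x : 'rV[R]_n) :
  enorm x ^+ 2 = \sum_(i < n) x 0 i ^+ 2.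
Proof. by rewrite sqr_sqrtr// sumr_ge0// => i _; exact: sqr_ge0. Qed.

Lemma coord_le_enorm {R : realType} {n} (x : 'rV[R]_n) i : `|x 0 i| <= enorm x.
Proof.
rewrite -ler_sqr ?nnegrE ?enorm_ge0// sqr_enorm real_normK ?num_real//.
rewrite (bigD1 i)//= lerDl sumr_ge0// => j _; exact: sqr_ge0.
Qed.

(** Transfers estimates in [enorm] to the library norm, in which completeness and separation of
    points are available. *)
Lemma mx_norm_le_enorm {R : realType} {n} (x : 'rV[R]_n) : `|x| <= enorm x.
Proof.
rewrite [`|x|]mx_normrE; apply: bigmax_le => [|[i j] _]; first exact: enorm_ge0.
by rewrite ord1; exact: coord_le_enorm.
Qed.

Lemma enorm_continuous (R : realType) n : continuous (@enorm R n).
Proof.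
have sq : continuous (fun x : 'rV[R]_n => \sum_(i < n) x 0 i ^+ 2).
  apply: (continuous_big (@add_continuous R)) => i _ x.
  apply: (@continuous_comp _ _ _ (fun y : 'rV[R]_n => y 0 i)
    (fun r : R => r ^+ 2)).
    exact: coord_continuous.
  exact: exprn_continuous.
by move=> x; apply: (continuous_comp (sq x)); exact: sqrt_continuous.
Qed.

(* A crude substitute for the triangle inequality, from
   [(a - b)^2 <= 2 (a^2 + b^2)]; only the existence of a bound matters. *)
Lemma enorm_sub_bounded {R : realType} {n} {A B : R} {x y : 'rV[R]_n} :
  enorm x <= A -> enorm y <= B ->
  enorm (x - y) <= Num.sqrt (2 * (A ^+ 2 + B ^+ 2)).
Proof.
move=> xA yB; rewrite ler_sqrt; last first.
  by rewrite mulr_ge0// addr_ge0// sqr_ge0.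
apply: (@le_trans _ _ (2 * (enorm x ^+ 2 + enorm y ^+ 2))).
  rewrite !sqr_enorm -big_split mulr_sumr ler_sum// => i _ /=.
  by rewrite !mxE; have := sqr_ge0 (x 0 i + y 0 i); nra.
have := enorm_ge0 x; have := enorm_ge0 y.
rewrite ler_pM2l// => y0 x0; rewrite lerD// ler_sqr ?nnegrE//.
- exact: le_trans x0 xA.
- exact: le_trans y0 yB.
Qed.

Lemma KL_mono {R : realType} {beta : R -> R -> R} {s s' t : R} :
  class_KL beta -> 0 <= s -> s <= s' -> 0 <= t -> beta s t <= beta s' t.
Proof.
move=> [K _] s0 + t0; rewrite le_eqVlt => /orP[/eqP->//|ss'].
by have [_ _ _ /(_ _ _ s0 ss')/ltW] := K _ t0.
Qed.

Lemma KL_cvg0 {R : realType} {beta : R -> R -> R} {s : R} :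
  class_KL beta -> 0 < s -> beta s j%:R @[j --> \oo] --> 0.
Proof.
move=> [_ L] /L[_ _ _]; apply: cvg_comp; exact: cvgr_idn.
Qed.

(** A comparison function takes real times, hence the real power. Written as
    [expR (- (t * ln lambda))] with [ln lambda > 0], its continuity, decrease and limit come from
    those of the exponential. *)
Lemma exp_class_KL (R : realType) (kappa lambda : R) :
  0 < kappa -> 1 < lambda -> class_KL (fun s t => kappa * s * lambda `^ (- t)).
Proof.
move=> k0 l1; have l0 : 0 < lambda by exact: lt_trans l1.
have lnl : 0 < ln lambda by rewrite ln_gt0.
have E t : lambda `^ (- t) = expR (- (t * ln lambda)).
  by rewrite /powR gt_eqF// mulNr.
have Ec : continuous (fun t : R => lambda `^ (- t)).
  rewrite (funext E) => x.
  apply: (@continuous_comp R R R (fun t : R => - (t * ln lambda)) (@expR R));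
    last exact: continuous_expR.
  by apply: cvgN; apply: cvgM; [exact: cvg_id|exact: cvg_cst].
split=> [t t0|s s0]; split.
- by move=> s s0; rewrite !mulr_ge0 ?powR_ge0// ltW.
- apply: continuous_subspaceT => x.
  by apply: cvgM; [apply: cvgM|]; by [exact: cvg_cst|exact: cvg_id].
- by rewrite mulr0 mul0r.
- by move=> s s' _ ss'; rewrite ltr_pM2r ?powR_gt0// ltr_pM2l.
- by move=> t t0; rewrite !mulr_ge0 ?powR_ge0// ltW.
- apply: continuous_subspaceT => x; apply: cvgM; first exact: cvg_cst.
  exact: Ec.
- move=> t t' _ tt'; rewrite ltr_pM2l ?mulr_gt0// !E ltr_expR ltrN2.
  by rewrite ltr_pM2r.
- rewrite -[X in _ --> X](mulr0 (kappa * s)); apply: cvgM; first exact: cvg_cst.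
  under eq_fun do rewrite E.
  apply: (@cvg_comp _ _ _ (fun t => t * ln lambda) (fun t => expR (- t)) _ +oo);
    last exact: cvgr_expR.
  by apply: gt0_cvgMly => //; exact: cvg_id.
Qed.

Section Flow.
Context {R : realType} {n : nat}.
Implicit Types (f : int -> 'rV[R]_n -> 'rV[R]_n) (x : int -> 'rV[R]_n).

Lemma phi_subn f k (j : nat) xi :
  phi f k (k - j%:Z) xi = phi_nat f (k - j%:Z) xi j.
Proof. by rewrite /phi subKr. Qed.

Lemma phi_nat_add f k0 xi i j :
  phi_nat f k0 xi (i + j) = phi_nat f (k0 + j%:Z) (phi_nat f k0 xi j) i.
Proof.
by elim: i => //= i ->; rewrite -addrA -PoszD addnC.
Qed.

(** The trajectory started at [k - i] passes through time [k - j]. Two pullback states at time [k]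
    thus become endpoints of trajectories with the common initial time [k - j], as incremental
    stability requires. *)
Lemma phi_pullback_comp f k (i j : nat) xi : (j <= i)%N ->
  phi f k (k - i%:Z) xi =
  phi f k (k - j%:Z) (phi f (k - j%:Z) (k - i%:Z) xi).
Proof.
move=> ji; have E : k - j%:Z = k - i%:Z + (i - j)%N%:Z.
  by rewrite -subzn// addrA subrK.
rewrite !phi_subn -[X in phi_nat _ _ _ X = _](subnKC ji).
by rewrite phi_nat_add -E; congr phi_nat; rewrite /phi E addrAC subrr add0r.
Qed.

Lemma phi_solution {f x} k k0 :
  (forall k, x (k + 1) = f k (x k)) -> k0 <= k -> phi f k k0 (x k0) = x k.
Proof.
move=> sx; rewrite -subr_ge0 /phi => h.
rewrite -[in RHS](subrKC k0 k); case: (k - k0) h => // m _ /=.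
elim: m => [|m IHm] /=; first by rewrite addr0.
by rewrite IHm -sx -addrA -PoszD addn1.
Qed.

(** A solution on all of the integers is itself the trajectory from [x k0], so it can be taken as
    the second trajectory. Leaving [beta] arbitrary covers both the asymptotic and the exponential
    rate. *)
Lemma incremental_attraction_bound f x beta :
  (forall xi1 xi2 k k0, k0 <= k -> enorm (phi f k k0 xi1 - phi f k k0 xi2)
      <= beta (enorm (xi1 - xi2)) (k - k0)%:~R) ->
  (forall k, x (k + 1) = f k (x k)) -> attraction_bound f x beta.
Proof.
by move=> st sx xi k k0 kk0; rewrite -(phi_solution _ _ sx kk0); exact: st.
Qed.

Lemma bounded_solution_unique f x y :
  incrementally_stable f -> bounded_solution f x -> bounded_solution f y ->
  x = y.
Proof.
move=> [beta [KL st]] [sx [A xA]] [sy [B yB]]; apply/funext => k.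
apply/eqP; rewrite -subr_eq0 -normr_le0.
(* The root bounds the distance between the two solutions at every time; adding 1 makes [C]
   positive, since decay of [beta C] is only known for positive [C]. *)
pose C : R := 1 + Num.sqrt (2 * (A ^+ 2 + B ^+ 2)).
have C0 : 0 < C by rewrite ltr_pwDl// sqrtr_ge0.
(* The left side does not depend on [j], so it suffices to bound it by [beta C j] for every [j]. *)
apply: (cvgr_to_ge (KL_cvg0 KL C0)); apply: nearW => j.
have kj : k - j%:Z <= k by rewrite gerBl.
rewrite -(phi_solution _ _ sx kj) -(phi_solution _ _ sy kj).
apply: le_trans (mx_norm_le_enorm _) _; apply: le_trans (st _ _ _ _ kj) _.
rewrite subKr; apply: (KL_mono KL) => //; first exact: enorm_ge0.
by apply: le_trans (enorm_sub_bounded (xA _) (yB _)) _; rewrite lerDr.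
Qed.

Lemma system_continuous f k : continuous_system f -> continuous (f k).
Proof.
move=> cf x; have := @continuous2_cvg _ (discrete_topology int) _ _ (nbhs x) _
  (fun=> k) id f k x (cf (k, x)).
by apply; [exact: cvg_cst | exact: cvg_id].
Qed.

Lemma bounded_solution_exists f :
  continuous_system f -> incrementally_stable f ->
  (exists X, [/\ X !=set0, compact X & positively_invariant f X]) ->
  exists x, bounded_solution f x.
Proof.
move=> cf [beta [KL st]] [X [[xi Xxi] cX iX]].
have [M XM] : exists M, forall y, X y -> enorm y <= M.
  have := @continuous_compact _ _ (@enorm R n) X
    (continuous_subspaceT (@enorm_continuous R n)) cX.
  move=> /compact_bounded[M [_ /(_ (M + 1))]]; rewrite ltrDl ltr01.
  move=> /(_ isT) b.
  exists (M + 1) => y Xy; apply: le_trans (ler_norm _) _.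
  by apply: b; exists y.
pose y k (j : nat) := phi f k (k - j%:Z) xi.
have yM k j : enorm (y k j) <= M by apply/XM/iX => //; rewrite gerBl.
pose C : R := 1 + Num.sqrt (2 * (M ^+ 2 + M ^+ 2)).
have C0 : 0 < C by rewrite ltr_pwDl// sqrtr_ge0.
have ycauchy k i j : (j <= i)%N -> `|y k j - y k i| <= beta C j%:R.
  move=> ji; rewrite /y [phi f k (k - i%:Z) xi](phi_pullback_comp _ _ _ _ _ ji).
  apply: le_trans (mx_norm_le_enorm _) _.
  apply: le_trans (st _ _ _ _ _) _; first by rewrite gerBl.
  rewrite subKr; apply: (KL_mono KL) => //; first exact: enorm_ge0.
  (* Seen at time [k - j], one trajectory starts at [xi] and the other has reached a point that
     invariance keeps in [X]; [C] bounds their distance. *)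
  have kij : k - i%:Z <= k - j%:Z by rewrite lerD2l lerN2 lez_nat.
  have := enorm_sub_bounded (XM _ Xxi) (XM _ (iX _ _ _ Xxi kij)).
  by move=> /le_trans; apply; rewrite lerDr.
have ycvg k : cvg (y k @ \oo).
  apply/cauchy_cvgP/cauchy_exP => e e0.
  (* The bound in [ycauchy] is independent of [i], so once [beta C N < e] the whole tail lies in the
     ball around [y k N]. *)
  have /cvgrPdist_lt/(_ _ e0)[N _ /(_ N (leqnn _))] := KL_cvg0 KL C0.
  rewrite /= sub0r normrN => bN.
  exists (y k N), N => // i /= Ni.
  rewrite -ball_normE /=; apply: le_lt_trans (ycauchy _ _ _ Ni) _.
  exact: le_lt_trans (ler_norm _) bN.
exists (fun k => lim (y k @ \oo)); split=> [k|]; last first.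
  exists M => k.
  have ecvg := continuous_cvg _ (enorm_continuous R n _) (ycvg k).
  by apply: (cvgr_to_le (ecvg _)); apply: nearW => j /=; exact: yM.
apply: (cvg_lim (@norm_hausdorff _ 'rV[R]_n)).
(* After the shift, [y (k + 1) j.+1] and [y k j] start at the same time [k - j], so they differ by
   one application of [f k]. *)
rewrite -(cvg_shiftS (y (k + 1))).
have -> : [sequence y (k + 1) j.+1]_j = f k \o y k.
  apply/funext => j /=; rewrite /y.
  have -> : k + 1 - j.+1%:Z = k - j%:Z.
    by rewrite -addn1 PoszD opprD addrACA subrr addr0.
  by rewrite phi_step// gerBl.
apply: cvg_comp (ycvg k) _; exact: system_continuous.
Qed.

End Flow.

Theorem theorem13 (R : realType) (n : nat)
    (f : int -> 'rV[R]_n -> 'rV[R]_n)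
    (f_cont : continuous_system f)
    (f_stable : incrementally_stable f)
    (f_compact : exists X : set 'rV[R]_n,
       [/\ X !=set0, compact X & positively_invariant f X]) :
  convergent_system f /\
  (exp_incrementally_stable f -> exp_convergent_system f).
Proof.
have [x bx] := bounded_solution_exists f f_cont f_stable f_compact.
have ux : unique (bounded_solution f) x.
  by split=> // y; exact: bounded_solution_unique.
have [sx _] := bx.
split=> [|[kappa [lambda [k1 l1 st]]]]; exists x; split=> //.
  have [beta [KL st]] := f_stable.
  by exists beta; split=> //; exact: incremental_attraction_bound.
have l0 : 0 <= lambda by rewrite ltW// (lt_trans ltr01).
(* At integer times the real power of the comparison function is the integer power of the stability
   hypothesis. *)
have powE (m : int) : lambda `^ (- m%:~R) = lambda ^ (- m).
  by rewrite -powR_intmul// mulrNz.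
exists (fun s t => kappa * s * lambda `^ (- t)); split.
- by apply: exp_class_KL => //; exact: lt_le_trans k1.
- apply: incremental_attraction_bound => // xi1 xi2 k k0 kk0.
  by rewrite powE; exact: st.
- by exists kappa, lambda; split=> // s k k0 _ _; rewrite powE.
Qed.
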